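(* Let $TG$ be a type graph, $T$ a graph typed over $TG$, $b_0\colon X \subseteq B_0$ a morphism in $\mathbf{Sub}(T)$, and $c$ a condition over $B_0$ in $\mathbf{Sub}(T)$. Then, for any graph $G$ in $\mathbf{Sub}(T)$ and any inclusion $\iota^X_G\colon X \subseteq G$, $$\iota^X_G \models_{\mathcal I} \exists\,(b_0, c) \iff \iota^X_G \models_{\mathcal I} \mathrm{Flat}(b_0, c).$$ In particular, for any graph $G$ in $\mathbf{Sub}(T)$ and any inclusion $\iota^{B_0}_G\colon B_0\subseteq G$, $$\iota^{B_0}_G \models_{\mathcal I} c \iff \iota^{B_0}_G \models_{\mathcal I} \mathrm{Flat}(\mathit{id}_{B_0}, c).$$
   Context: **Graphs.** A graph $G=(V_G,E_G,\mathit{src}_G,\mathit{tar}_G)$ consists of a set of nodes, a set of edges, and source and target functions $E_G\to V_G$; graph morphisms are pairs of functions on nodes and edges compatible with source and target. A type graph $TG$ is a fixed graph; a graph typed over $TG$ is a graph $G$ with a graph morphism $\mathit{type}_G\colon G\to TG$. A subgraph $H\subseteq G$ of a typed graph $G$ has $V_H\subseteq V_G$, $E_H\subseteq E_G$, with $\mathit{src}_H,\mathit{tar}_H,\mathit{type}_H$ the restrictions of those of $G$. **Category $\mathbf{Sub}(T)$.** Objects are the subgraphs $G\subseteq T$; morphisms are the inclusions between such subgraphs. So there is at most one morphism between any two objects, and all morphisms are monomorphisms. **Conditions in $\mathbf{Sub}(T)$.** Conditions over an object $B_0$ are defined recursively: $\mathsf{true}$ is a condition over $B_0$; if $b_1\colon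 B_0\subseteq B_1$ is a morphism in $\mathbf{Sub}(T)$ and $d$ is a condition over $B_1$, then $\exists\,(b_1\colon B_0\subseteq B_1, d)$ is a condition over $B_0$; (finite) Boolean combinations (via $\neg,\wedge,\vee$) of conditions over $B_0$ are conditions over $B_0$. $\mathsf{false}$ denotes $\neg\mathsf{true}$. **Satisfaction $\models_{\mathcal I}$ in $\mathbf{Sub}(T)$.** Let $\iota^{B_0}_G\colon B_0\subseteq G$ be an inclusion with $G\in\mathbf{Sub}(T)$. Every such inclusion satisfies $\mathsf{true}$; $\iota^{B_0}_G\models_{\mathcal I}\exists\,(b_1\colon B_0\subseteq B_1,d)$ iff there is an inclusion $\iota^{B_1}_G\colon B_1\subseteq G$ (necessarily with $\iota^{B_1}_G\circ b_1=\iota^{B_0}_G$) such that $\iota^{B_1}_G\models_{\mathcal I} d$; Boolean operators are interpreted as usual. **Flattening.** For a morphism $b_0$ in $\mathbf{Sub}(T)$ with codomain $B_0$ and a condition $c$ over $B_0$, the condition $\mathrm{Flat}(b_0,c)$ (over the domain of $b_0$) is defined recursively by - $\mathrm{Flat}(b_0,\mathsf{true})=\exists\,(b_0,\mathsf{true})$; - $\mathrm{Flat}(b_0,\neg\mathsf{true})=\exists\,(b_0,\mathsf{false})\equiv\mathsf{false}$; - $\mathrm{Flat}(b_0,d_1\odot d_2)=\mathrm{Flat}(b_0,d_1)\odot\mathrm{Flat}(b_0,d_2)$; - $\mathrm{Flat}(b_0,\neg(d_1\odot d_2))=\mathrm{Flat}(b_0,\neg d_1)\,\overline{\odot}\,\mathrm{Flat}(b_0,\neg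 d_2)$; - $\mathrm{Flat}(b_0,\exists\,(b_1\colon B_0\subseteq B_1,d))=\mathrm{Flat}(b_1\circ b_0,d)$; - $\mathrm{Flat}(b_0,\neg\exists\,(b_1\colon B_0\subseteq B_1,d))=\exists\,(b_0,\mathsf{true})\wedge\neg\mathrm{Flat}(b_1\circ b_0,d)$; - $\mathrm{Flat}(b_0,\neg\neg c)=\mathrm{Flat}(b_0,c)$; where $\odot\in\{\wedge,\vee\}$, $\overline\wedge=\vee$, $\overline\vee=\wedge$. *)

(* Defs.v *)
From mathcomp Require Import all_boot.
From mathcomp Require Import classical_sets.

Set Implicit Arguments.
Unset Strict Implicit.
Unset Printing Implicit Defensive.

Local Open Scope classical_set_scope.

Record graph := Graph {
  node : Type;
  edge : Type;
  src : edge -> node;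
  tar : edge -> node }.

Record graph_hom (G H : graph) := GraphHom {
  hom_node : node G -> node H;
  hom_edge : edge G -> edge H;
  hom_src : forall e, hom_node (src e) = src (hom_edge e);
  hom_tar : forall e, hom_node (tar e) = tar (hom_edge e) }.

Record typed_graph (TG : graph) := TypedGraph {
  untyped :> graph;
  typing : graph_hom untyped TG }.

(* Source, target and typing of a subgraph are restrictions of those of T, so
   the node set and the edge set determine it; [subgraph_typed] below is the
   resulting typed graph. *)
Record subgraph (TG : graph) (T : typed_graph TG) := Subgraph {
  sub_node : set (node T);
  sub_edge : set (edge T);
  sub_src : forall e, sub_edge e -> sub_node (src e);
  sub_tar : forall e, sub_edge e -> sub_node (tar e) }.

Definition subgraph_graph (TG : graph) (T : typed_graph TG) (H : subgraph T) :
    graph :=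
  @Graph {v : node T | sub_node H v} {e : edge T | sub_edge H e}
    (fun e => exist _ (src (sval e)) (sub_src (svalP e)))
    (fun e => exist _ (tar (sval e)) (sub_tar (svalP e))).

Definition subgraph_typed (TG : graph) (T : typed_graph TG) (H : subgraph T) :
    typed_graph TG :=
  @TypedGraph TG (subgraph_graph H)
    (@GraphHom (subgraph_graph H) TG
      (fun v => hom_node (typing T) (sval v))
      (fun e => hom_edge (typing T) (sval e))
      (fun e => hom_src (typing T) (sval e))
      (fun e => hom_tar (typing T) (sval e))).

(* The morphisms of Sub(T).  Being an inclusion is a proposition, so there is
   at most one morphism between two objects and all diagrams commute. *)
Definition incl (TG : graph) (T : typed_graph TG) (G H : subgraph T) : Prop :=
  (sub_node G `<=` sub_node H) /\ (sub_edge G `<=` sub_edge H).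

Lemma incl_id (TG : graph) (T : typed_graph TG) (G : subgraph T) : incl G G.
Proof. by split. Qed.

Lemma incl_comp (TG : graph) (T : typed_graph TG) (G H K : subgraph T) :
  incl H K -> incl G H -> incl G K.
Proof.
by move=> [HKn HKe] [GHn GHe]; split;
  [exact: subset_trans HKn | exact: subset_trans HKe].
Qed.

Inductive condition (TG : graph) (T : typed_graph TG) : subgraph T -> Type :=
| CTrue (B0 : subgraph T) : condition B0
| CExists (B0 B1 : subgraph T) (b1 : incl B0 B1) (d : condition B1) :
    condition B0
| CNot (B0 : subgraph T) (d : condition B0) : condition B0
| CAnd (B0 : subgraph T) (d1 d2 : condition B0) : condition B0
| COr (B0 : subgraph T) (d1 d2 : condition B0) : condition B0.

Arguments CTrue {TG T B0}.

Definition CFalse (TG : graph) (T : typed_graph TG) (B0 : subgraph T) :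
  condition B0 := CNot CTrue.
Arguments CFalse {TG T B0}.

Fixpoint sat (TG : graph) (T : typed_graph TG) (B0 G : subgraph T)
    (iota : incl B0 G) (c : condition B0) {struct c} : Prop :=
  match c in condition B return incl B G -> Prop with
  | CTrue _ => fun _ => True
  | @CExists _ _ _ B1 _ d => fun _ => exists iota1 : incl B1 G, sat iota1 d
  | CNot _ d => fun i => ~ sat i d
  | CAnd _ d1 d2 => fun i => sat i d1 /\ sat i d2
  | COr _ d1 d2 => fun i => sat i d1 \/ sat i d2
  end iota.

(* [flat b0 c] is Flat(b0, c) and [flat_neg b0 c] is Flat(b0, not c); splitting
   the two makes the recursion structural.  The defining equations of Flat are
   the lemmas [flat_*] below. *)
Fixpoint flat (TG : graph) (T : typed_graph TG) (X B0 : subgraph T)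
    (b0 : incl X B0) (c : condition B0) {struct c} : condition X :=
  match c in condition B return incl X B -> condition X with
  | CTrue _ => fun b0 => CExists b0 CTrue
  | CExists _ _ b1 d => fun b0 => flat (incl_comp b1 b0) d
  | CNot _ d => fun b0 => flat_neg b0 d
  | CAnd _ d1 d2 => fun b0 => CAnd (flat b0 d1) (flat b0 d2)
  | COr _ d1 d2 => fun b0 => COr (flat b0 d1) (flat b0 d2)
  end b0
with flat_neg (TG : graph) (T : typed_graph TG) (X B0 : subgraph T)
    (b0 : incl X B0) (c : condition B0) {struct c} : condition X :=
  match c in condition B return incl X B -> condition X with
  | CTrue _ => fun b0 => CExists b0 CFalse
  | CExists _ _ b1 d => fun b0 =>
      CAnd (CExists b0 CTrue) (CNot (flat (incl_comp b1 b0) d))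
  | CNot _ d => fun b0 => flat b0 d
  | CAnd _ d1 d2 => fun b0 => COr (flat_neg b0 d1) (flat_neg b0 d2)
  | COr _ d1 d2 => fun b0 => CAnd (flat_neg b0 d1) (flat_neg b0 d2)
  end b0.

Lemma flat_true (TG : graph) (T : typed_graph TG) (X B0 : subgraph T)
    (b0 : incl X B0) :
  flat b0 CTrue = CExists b0 CTrue.
Proof. by []. Qed.

Lemma flat_not_true (TG : graph) (T : typed_graph TG) (X B0 : subgraph T)
    (b0 : incl X B0) :
  flat b0 (CNot CTrue) = CExists b0 CFalse.
Proof. by []. Qed.

Lemma flat_and (TG : graph) (T : typed_graph TG) (X B0 : subgraph T)
    (b0 : incl X B0) (c1 c2 : condition B0) :
  flat b0 (CAnd c1 c2) = CAnd (flat b0 c1) (flat b0 c2).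
Proof. by []. Qed.

Lemma flat_or (TG : graph) (T : typed_graph TG) (X B0 : subgraph T)
    (b0 : incl X B0) (c1 c2 : condition B0) :
  flat b0 (COr c1 c2) = COr (flat b0 c1) (flat b0 c2).
Proof. by []. Qed.

Lemma flat_not_and (TG : graph) (T : typed_graph TG) (X B0 : subgraph T)
    (b0 : incl X B0) (c1 c2 : condition B0) :
  flat b0 (CNot (CAnd c1 c2)) = COr (flat b0 (CNot c1)) (flat b0 (CNot c2)).
Proof. by []. Qed.

Lemma flat_not_or (TG : graph) (T : typed_graph TG) (X B0 : subgraph T)
    (b0 : incl X B0) (c1 c2 : condition B0) :
  flat b0 (CNot (COr c1 c2)) = CAnd (flat b0 (CNot c1)) (flat b0 (CNot c2)).
Proof. by []. Qed.

Lemma flat_exists (TG : graph) (T : typed_graph TG) (X B0 B1 : subgraph T)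
    (b0 : incl X B0) (b1 : incl B0 B1) (d : condition B1) :
  flat b0 (CExists b1 d) = flat (incl_comp b1 b0) d.
Proof. by []. Qed.

Lemma flat_not_exists (TG : graph) (T : typed_graph TG) (X B0 B1 : subgraph T)
    (b0 : incl X B0) (b1 : incl B0 B1) (d : condition B1) :
  flat b0 (CNot (CExists b1 d)) =
  CAnd (CExists b0 CTrue) (CNot (flat (incl_comp b1 b0) d)).
Proof. by []. Qed.

Lemma flat_not_not (TG : graph) (T : typed_graph TG) (X B0 : subgraph T)
    (b0 : incl X B0) (c : condition B0) :
  flat b0 (CNot (CNot c)) = flat b0 c.
Proof. by []. Qed.

(* Main.v *)
From mathcomp Require Import all_boot.
From mathcomp Require Import boolp.
Require Import Defs.

Set Implicit Arguments.
Unset Strict Implicit.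

(** Flattening distributes every quantifier over the Boolean structure below it
    and composes the inclusions met on the way.  In general an existential does
    not distribute over conjunction, but in Sub(T) an inclusion into G, if there
    is one, is unique: [exists (b0, _)] makes no choice, it only asserts that B0
    is contained in G.  Hence everything splits on whether B0 is contained in G.

    If it is not, [exists (b0, c)] is false, and so must be [flat b0 c].  This
    is why Flat conjoins [exists (b0, true)] to each negated flattening;
    [sat_flat_incl] is the contrapositive.  If it is, then [flat b0 c] and [c]
    are equivalent at G ([sat_flatE]): the Boolean clauses are de Morgan's laws,
    and in the clauses for an existential over B1, [sat_flat_incl] provides the
    inclusion of B1 that the flattened condition no longer mentions.

    Because Flat pushes negations inward, both facts are proved simultaneously
    for a condition and for its negation. *)

(** Apart from conjunctions and disjunctions, a flattened condition consists of
    existentials [exists (b, _)] whose inclusion [b] extends [b0], and of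
    negations guarded by the conjunct [exists (b, true)].  Satisfying either
    puts the codomain of [b], which contains B0, into G. *)
Lemma sat_flat_incl (TG : graph) (T : typed_graph TG) (B0 : subgraph T)
    (c : condition B0) (X G : subgraph T) (b0 : incl X B0) (iota : incl X G) :
  (sat iota (flat b0 c) -> incl B0 G) /\
  (sat iota (flat_neg b0 c) -> incl B0 G).
Proof.
elim: c X b0 iota => {B0}
  [B0 | B0 B1 b1 d IH | B0 d IH | B0 d1 IH1 d2 IH2 | B0 d1 IH1 d2 IH2]
  X b0 iota /=.
- by split=> -[].
- split; last by case=> -[].
  by move=> /(IH _ _ _).1 B1G; exact: incl_comp B1G b1.
- by have [IHp IHn] := IH X b0 iota.
- have [IHp1 IHn1] := IH1 X b0 iota; have [_ IHn2] := IH2 X b0 iota.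
  by split=> [[/IHp1] | [/IHn1 | /IHn2]].
- have [IHp1 IHn1] := IH1 X b0 iota; have [IHp2 _] := IH2 X b0 iota.
  by split=> [[/IHp1 | /IHp2] | [/IHn1]].
Qed.

(** Once B0 is contained in G, the prefix [b0] carries no information.  The
    inclusions [iota] and [j] need not be related by [b0]: diagrams in Sub(T)
    commute automatically. *)
Lemma sat_flatE (TG : graph) (T : typed_graph TG) (B0 : subgraph T)
    (c : condition B0) (X G : subgraph T) (b0 : incl X B0) (iota : incl X G)
    (j : incl B0 G) :
  (sat iota (flat b0 c) <-> sat j c) /\
  (sat iota (flat_neg b0 c) <-> ~ sat j c).
Proof.
elim: c X b0 iota j => {B0}
  [B0 | B0 B1 b1 d IH | B0 d IH | B0 d1 IH1 d2 IH2 | B0 d1 IH1 d2 IH2]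
  X b0 iota j /=.
- by split; split=> // -[].
- have flatE : sat iota (flat (incl_comp b1 b0) d) <->
      exists j1 : incl B1 G, sat j1 d.
    have flat_d j1 := (IH X (incl_comp b1 b0) iota j1).1.
    split=> [sat_d | [j1 /flat_d]] //.
    have j1 := (sat_flat_incl _ _ _).1 sat_d.
    by exists j1; apply/flat_d.
  split=> //; rewrite flatE.
  by split=> [[] | not_d] //; split=> //; exists j.
- have [IHp IHn] := IH X b0 iota j.
  by split=> //; rewrite IHp not_notE.
- have [IHp1 IHn1] := IH1 X b0 iota j; have [IHp2 IHn2] := IH2 X b0 iota j.
  by rewrite IHp1 IHp2 IHn1 IHn2 not_andE.
- have [IHp1 IHn1] := IH1 X b0 iota j; have [IHp2 IHn2] := IH2 X b0 iota j.
  by rewrite IHp1 IHp2 IHn1 IHn2 not_orE.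
Qed.

Theorem theorem3 (TG : graph) (T : typed_graph TG) (X B0 : subgraph T)
    (b0 : incl X B0) (c : condition B0) :
  (forall (G : subgraph T) (iota : incl X G),
      sat iota (CExists b0 c) <-> sat iota (flat b0 c)) /\
  (forall (G : subgraph T) (iota : incl B0 G),
      sat iota c <-> sat iota (flat (incl_id B0) c)).
Proof.
split=> G iota; last by have [-> _] := sat_flatE c (incl_id B0) iota iota.
have flatE j := (sat_flatE c b0 iota j).1.
split=> [[j /flatE] | sat_flat] //.
have j := (sat_flat_incl _ _ _).1 sat_flat.
by exists j; apply/flatE.
Qed.
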